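(* Let $\nu:[0,1] \to \mathbb{R}$ be continuous with $\nu(x) > 0$ for all $x\in[0,1]$. Let $f:[0,1] \to \mathbb{R}$ be differentiable with $f(0) = 0$. Then $$\int_{0}^{1}|f(x)|\,\nu(x)\, dx \leq \left(\max_{0 \leq x \leq 1}\frac{1}{\nu(x)}\int_{x}^{1}\nu(z)\,dz\right)\int_{0}^{1}|f'(x)|\,\nu(x)\, dx,$$ and the constant is sharp: for the given weight $\nu$, no smaller constant makes this inequality hold for all such $f$. *)

(* Defs.v *)
From HB Require Import structures.
From mathcomp Require Import all_boot all_order all_algebra.
From mathcomp Require Import all_classical all_reals all_analysis.
Set Implicit Arguments. Unset Strict Implicit. Unset Printing Implicit Defensive.
Import Order.TTheory GRing.Theory Num.Theory.
Import numFieldNormedType.Exports.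
Local Open Scope classical_set_scope.
Local Open Scope ring_scope.

Definition differentiable01 (R : realType) (f : R -> R) : Prop :=
  [/\ {in `]0, 1[, forall x, derivable f x 1},
      cvg ((fun h : R => h^-1 * (f h - f 0)) @ 0^'+) &
      cvg ((fun h : R => h^-1 * (f (1 + h) - f 1)) @ 0^'-)].

Definition tail_ratio (R : realType) (nu : R -> R) (x : R) : R :=
  (nu x)^-1 * Rintegral (@lebesgue_measure R) `[x, 1] nu.

(* Main.v *)
Require Import Defs.
From HB Require Import structures.
From mathcomp Require Import all_boot all_order all_algebra.
From mathcomp Require Import all_classical all_reals all_analysis measurable_realfun.
From mathcomp Require Import ring lra.
Import Order.TTheory GRing.Theory Num.Theory.
Import numFieldNormedType.Exports.
Local Open Scope classical_set_scope.
Local Open Scope ring_scope.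

(** The inequality follows from |f(y)| <= int_0^y |f'| and Tonelli's theorem:
    the weight collected by |f'(t)| is int_t^1 nu <= C nu(t).  Since f' is only
    assumed to exist, the fundamental theorem of calculus is not available; the
    bound on |f(y)| is obtained by covering each level set
    {n e <= |f'| < (n+1) e} by an open set U_n of nearly the same measure and
    propagating |f(x)| <= e + sum_n (n+1) e mu(U_n /\ [0, x]) from left to
    right.  For sharpness, take f to be a C^1 step rising from 0 to 1 just to
    the right of a maximiser x0: then int |f'| nu is close to nu(x0), and
    int |f| nu is close to int_x0^1 nu = C nu(x0). *)

(** * Induction along a real interval, and preliminaries on derivatives *)

(** Consider the infimum of the counterexamples: [P] holds below it, hence at it by the left-limit
    hypothesis, hence slightly beyond it, which leaves no counterexample close to the infimum. *)
Lemma interval_induction (R : realType) (a b : R) (P : R -> Prop) :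
  P a ->
  (forall x, a <= x < b -> P x ->
    exists2 d : R, 0 < d & forall y, x < y < x + d -> y <= b -> P y) ->
  (forall x, a < x <= b -> (forall y, a <= y < x -> P y) -> P x) ->
  forall x, a <= x <= b -> P x.
Proof.
move=> Pa Pr Pl x /andP[ax xb]; apply: contrapT => nPx.
pose S := [set y | a <= y <= b /\ ~ P y].
have Sx : S x by split=> //; rewrite ax.
have Sinf : has_inf S by split; [exists x | exists a => y [/andP[]]].
have aS : a <= inf S by apply: lb_le_inf; [exists x | move=> y [/andP[]]].
have Sb : inf S <= b.
  by apply: le_trans xb; apply: ge_inf => //; exact: Sinf.2.
have below y : a <= y < inf S -> P y.
  move=> /andP[ay yS]; apply: contrapT => nPy.
  have : inf S <= y.
    apply: ge_inf; first exact: Sinf.2.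
    by split=> //; rewrite ay (le_trans (ltW yS)).
  by rewrite leNgt yS.
have PS : P (inf S).
  have [<-//|aS'] := eqVneq a (inf S).
  by apply: Pl => //; rewrite lt_neqAle aS' aS.
have Slt : inf S < b.
  rewrite lt_neqAle Sb andbT; apply/negP => /eqP Sbeq; apply: nPx.
  have : x <= inf S by rewrite Sbeq.
  rewrite le_eqVlt => /predU1P[->//|xS].
  by apply: below; rewrite ax.
have [|d d0 Pd] := Pr (inf S) _ PS; first by rewrite aS.
have [y [/andP[ay yb] nPy] yS] := inf_adherent d0 Sinf.
apply: (nPy); have [->//|yneq] := eqVneq y (inf S).
apply: Pd => //; rewrite yS andbT lt_neqAle eq_sym yneq /=.
by apply: ge_inf; [exact: Sinf.2 | split=> //; rewrite ay yb].
Qed.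

Lemma derivable1_cvg (R : numFieldType) (f : R -> R) (x : R) :
  derivable f x 1 -> h^-1 * (f (h + x) - f x) @[h --> 0^'] --> derive1 f x.
Proof.
move=> df; rewrite derive1E /derive.
have -> : (fun h => h^-1 * (f (h + x) - f x)) =
          (fun h => h^-1 *: ((f \o shift x) (h *: 1) - f x)).
  by apply/funext => h /=; rewrite [h *: 1]mulr1.
exact: df.
Qed.

Lemma derive1_lt_near (R : realFieldType) (f : R -> R) (x M : R) :
  derivable f x 1 -> `|derive1 f x| < M ->
  exists2 d : R, 0 < d & forall y, `|y - x| < d ->
    `|f y - f x| <= M * `|y - x|.
Proof.
move=> /derivable1_cvg df fM.
have [d /= d0 dP] := cvgr_lt _ (cvg_norm df) _ fM; exists d => // y yd.
have [->|yx] := eqVneq y x; first by rewrite !subrr normr0 mulr0.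
have yx0 : y - x != 0 by rewrite subr_eq0.
have := dP (y - x); rewrite /ball_ /= sub0r normrN subrK => /(_ yd yx0).
by rewrite normrM normfV mulrC ltr_pdivrMr ?normr_gt0// => /ltW.
Qed.

(** On [D] the derivative is the pointwise limit of the difference quotients of step 1/(n+1).
    Extending [f] by 0 outside [D] makes these quotients measurable everywhere, and openness of [D]
    keeps the shifted point in [D] for large n. *)
Lemma measurable_derive1 (R : realType) (D : set R) (f : R -> R) :
  open D -> {in D, forall x, derivable f x 1} -> measurable_fun D (derive1 f).
Proof.
move=> oD df; have mD : measurable D by exact: open_measurable.
have mf : measurable_fun setT (f \_ D).
  apply/(measurable_restrict _ mD measurableT); rewrite setTI.
  apply: open_continuous_measurable_fun => // x xD.
  exact/differentiable_continuous/derivable1_diffP/df.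
pose h n := n.+1%:R^-1 : R.
apply: (@measurable_fun_cvg _ _ _ _
  (fun n x => (h n)^-1 * ((f \_ D) (h n + x) - (f \_ D) x))).
  move=> n; apply: measurable_funTS; apply: measurable_funM => //.
  by apply: measurable_funB => //; apply: measurableT_comp => //; exact: measurable_funD.
move=> x Dx; have /derivable1_cvg dfx := df x (mem_set Dx).
have h0 : (forall n, h n != 0) /\ h n @[n --> \oo] --> 0.
  by split; [move=> n; rewrite /h invr_eq0 pnatr_eq0 | exact: cvg_harmonic].
have /cvgr_dnbhsP/(_ h h0) cf := dfx.
apply: cvg_trans cf; apply: near_eq_cvg.
have : \forall y \near x, D y by exact: open_nbhs_nbhs.
move=> [d /= d0 dD].
have [N _ hN] : \forall n \near \oo, h n < d by exact: near_infty_natSinv_lt (PosNum d0).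
exists N => // n /= Nn; rewrite !patchE !mem_set//.
apply: dD; rewrite /ball_ /= opprD addrCA subrr addr0 normrN ger0_norm ?invr_ge0//.
exact: hN.
Qed.

(** * Bounding an increment by the integral of the absolute derivative *)

Local Open Scope ereal_scope.

(** Interval induction on the right endpoint: just to the right of a point of [U n] where |f'| <
    [M n], the increment of [f] grows at rate at most [M n], while the sum on the right grows at
    rate at least [M n]. The slack [e] starts the induction at [a], where only continuity is
    available. *)
Lemma increment_le_cover (R : realType) (f : R -> R) (a b : R)
    (U : nat -> set R) (M : nat -> R) (e : R) :
  (a <= b)%R -> {within `[a, b], continuous f} ->
  {in `]a, b[%R, forall x, derivable f x 1} ->
  (forall n, open (U n)) -> (forall n, 0 <= M n)%R ->
  (forall x, x \in `]a, b[%R -> exists2 n, U n x & `|derive1 f x| < M n)%R ->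
  (0 < e)%R ->
  `|f b - f a|%:E <=
  e%:E + \sum_(n <oo) (M n)%:E * lebesgue_measure (U n `&` `[a, b]).
Proof.
move=> ab cf df oU M0 UM e0.
have MU0 n A : 0 <= (M n)%:E * lebesgue_measure A by rewrite mule_ge0 ?lee_fin.
have [<-|a_neq_b] := eqVneq a b.
  rewrite subrr normr0; apply: adde_ge0; first by rewrite lee_fin ltW.
  by apply: nneseries_ge0 => n _ _; exact: MU0.
have {a_neq_b} altb : (a < b)%R by rewrite lt_neqAle a_neq_b.
have [cfo cfa cfb] := (continuous_within_itvP f altb).1 cf.
pose Phi (x : R) : \bar R := \sum_(n <oo) (M n)%:E * lebesgue_measure (U n `&` `[a, x]).
have mU n : measurable (U n : set (measurableTypeR R)) by exact: open_measurable.
have Phi0 x : 0 <= Phi x by apply: nneseries_ge0 => n _ _; exact: MU0.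
(* [Phi] is additive over [[a, x]] and []x, y]]; of the second contribution only the term of index
   [n] is kept. *)
have PhiS n x y : (a <= x <= y)%R -> `]x, y[ `<=` U n ->
    Phi x + (M n * (y - x))%:E <= Phi y.
  move=> /andP[ax xy] Un.
  have -> : Phi y = Phi x +
      \sum_(k <oo) (M k)%:E * lebesgue_measure (U k `&` `]x, y]).
    rewrite -nneseriesD; [|by move=> *; exact: MU0..].
    apply: eq_eseriesr => k _; rewrite -ge0_muleDr// -measureU//.
    - by congr (_ * lebesgue_measure _); rewrite -setIUr -itv_bndbnd_setU// bnd_simp.
    - exact: measurableI.
    - exact: measurableI.
    - rewrite setIACA setIid (_ : `[a, x] `&` `]x, y] = set0) ?setI0//.
      by apply/seteqP; split=> // z /= []; rewrite !in_itv/= => /andP[_ zx] /andP[/lt_geF]; rewrite zx.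
  apply: leeD2l; rewrite (@nneseriesD1 _ _ n)//.
  rewrite -[leLHS]adde0; apply: leeD; last by apply: nneseries_ge0 => *; exact: MU0.
  rewrite EFinM; apply: lee_wpmul2l; first by rewrite lee_fin.
  apply: (@le_trans _ _ (lebesgue_measure `]x, y[)).
    rewrite lebesgue_measure_itv /= lte_fin.
    by case: ltP => // yx; rewrite lee_fin subr_le0.
  apply: le_measure; rewrite ?inE //; first exact: measurableI.
  by move=> z zxy; split; [exact: Un|apply: subset_itvl zxy; rewrite bnd_simp].
have P0 : `|f a - f a|%:E <= e%:E + Phi a.
  by rewrite subrr normr0 adde_ge0// lee_fin ltW.
pose P x := `|f x - f a|%:E <= e%:E + Phi x.
suff : forall x, (a <= x <= b)%R -> P x by move=> /(_ b); apply; rewrite ab lexx.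
apply: (@interval_induction R a b P P0); rewrite {}/P.
  move=> x /andP[]; rewrite le_eqVlt => /predU1P[<- _ _|ax xb Px].
    have /cvgrPdist_lt/(_ _ e0)[d /= d0 dP] := cfa.
    exists d => // y /andP[ay yd] _.
    apply: (@le_trans _ _ e%:E); last by rewrite leeDl.
    rewrite lee_fin distrC ltW// dP// /ball_ /= distrC ger0_norm ?subr_ge0 ?ltW//.
    by rewrite ltrBlDl.
  have xab : x \in `]a, b[%R by rewrite in_itv/= ax.
  have [n Unx fM] := UM x xab.
  have [d1 d10 d1P] := derive1_lt_near _ _ _ _ (df x xab) fM.
  have [d2 /= d20 d2P] : \forall y \near x, U n y by exact: open_nbhs_nbhs.
  exists (Num.min d1 d2); first by rewrite lt_min d10.
  move=> y /andP[xy yd] yb.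
  have yx : (`|y - x| = y - x)%R by rewrite ger0_norm// subr_ge0 ltW.
  have := yd; rewrite -ltrBlDl lt_min => /andP[yd1 yd2].
  have fyx : `|f y - f a|%:E <= `|f x - f a|%:E + (M n * (y - x))%:E.
    rewrite -EFinD lee_fin (le_trans (ler_distD (f x) _ _))// addrC.
    by rewrite lerD2l -yx d1P// yx.
  apply: (le_trans fyx); apply: le_trans (leeD2r _ Px) _.
  rewrite -addeA leeD2l// PhiS//; first by rewrite !ltW.
  move=> z /=; rewrite in_itv/= => /andP[xz zy]; apply: d2P.
  rewrite /ball_ /= distrC ger0_norm ?subr_ge0 ?ltW//.
  by apply: lt_trans yd2; rewrite ltrD2r.
move=> x /andP[ax xb] Py.
have Phile y : (a <= y < x)%R -> Phi y <= Phi x.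
  move=> /andP[ay yx]; apply: lee_nneseries => [*|n _]; first by exact: MU0.
  apply: lee_wpmul2l; first by rewrite lee_fin.
  apply: le_measure; rewrite ?inE; [exact: measurableI|exact: measurableI|].
  by apply: setIS; apply: subset_itvl; rewrite bnd_simp ltW.
have cfx : f y @[y --> x^'-] --> f x.
  move: xb; rewrite le_eqVlt => /predU1P[->//|xb].
  by apply: cvg_at_left_filter; apply: cfo; rewrite in_itv/= ax.
(* If [Phi x] is finite, a strict failure at [x] persists by continuity at points y slightly to the
   left, where [Phi y <= Phi x] contradicts the induction hypothesis. An infinite [Phi x] makes the
   bound trivial. *)
rewrite leNgt; apply/negP; move Phix: (Phi x) Phile => p; case: p Phix => [p Phix|Phix Phile|Phix].
- move=> Phile; rewrite -EFinD lte_fin => h.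
  have /cvg_norm cfxa : (f y - f a)%R @[y --> x^'-] --> (f x - f a)%R.
    by apply: cvgB => //; exact: cvg_cst.
  have yh : \forall y \near x^'-, (e + p < `|f y - f a|)%R.
    by apply: (cvgr_gt _ cfxa).
  have /filter_ex[y [/andP[ay yx] hy]] :
      \forall y \near x^'-, (a <= y < x)%R /\ (e + p < `|f y - f a|)%R.
    near=> y; split; last by near: y.
    apply/andP; split; last by near: y; exact: nbhs_left_lt.
    by near: y; exact: nbhs_left_ge.
  have := Py y; rewrite ay yx => /(_ isT) /(fun h => le_trans h (leeD2l _ (Phile y _))).
  by rewrite ay yx => /(_ isT); rewrite -EFinD lee_fin leNgt hy.
- by rewrite addey// ltNge leey.
- by move=> _; have := Phi0 x; rewrite Phix.
Unshelve. all: by end_near. Qed.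

(** The cover of the previous lemma comes from outer regularity applied to the level sets of |f'| at
    scale [e]. Its weighted measure is then at most the integral of |f'| + [e], up to one further
    [e]. *)
Lemma increment_le_integral_derive1 (R : realType) (f : R -> R) (a b : R) :
  (a <= b)%R -> {within `[a, b], continuous f} ->
  {in `]a, b[%R, forall x, derivable f x 1} ->
  `|f b - f a|%:E <=
  \int[@lebesgue_measure R]_(x in `]a, b[) `|derive1 f x|%:E.
Proof.
move=> ab cf df; pose mu := @lebesgue_measure R.
pose D : set (measurableTypeR R) := `]a, b[%classic.
have mD : measurable D by exact: measurable_itv.
have mf' : measurable_fun D (fun x => `|derive1 f x|%R).
  apply: measurableT_comp => //; apply: measurable_derive1 => //.
  by move=> x; rewrite inE; exact: df.
apply/lee_addgt0Pr => r r0.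
have ba0 : (0 <= b - a)%R by rewrite subr_ge0.
(* The three terms pay for the slack of the covering lemma, the excess measure of the open sets, and
   the rounding of |f'| up to a multiple of [e]. *)
have [e e0 rE] : exists2 e : R, (0 < e)%R & (r = e + e + e * (b - a))%R.
  exists (r / (b - a + 2))%R; first by rewrite divr_gt0// ltr_wpDl.
  field; lra.
have muD : mu D = (b - a)%:E.
  rewrite /mu /D lebesgue_measure_itv/= lte_fin -EFinD.
  case: ltP => // ba; congr EFin; lra.
pose M (n : nat) := (n.+1%:R * e)%R.
have M0 n : (0 < M n)%R by rewrite mulr_gt0.
pose E n : set (measurableTypeR R) :=
  D `&` [set x | (n%:R * e <= `|derive1 f x| < M n)%R].
have mE n : measurable (E n).
  have -> : E n = D `&` (fun x => `|derive1 f x|%R) @^-1` `[(n%:R * e)%R, M n[.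
    by apply/seteqP; split=> x [Dx] /=; rewrite in_itv/=.
  exact: mf'.
(* The index of a level set is a function of the point, so the [E n] are disjoint and cover [D]. *)
have En x n : E n x -> n = Num.truncn (`|derive1 f x| / e).
  move=> [_ /andP[nx xn]]; apply/esym/truncn_def.
  by rewrite ler_pdivlMr// ltr_pdivrMr// nx.
have DE : D = \bigcup_n E n.
  apply/seteqP; split=> [x Dx|x [n _ []//]].
  exists (Num.truncn (`|derive1 f x| / e)) => //; split=> //=.
  have /truncn_itv : (0 <= `|derive1 f x| / e)%R by rewrite divr_ge0// ltW.
  by rewrite ler_pdivlMr// ltr_pdivrMr.
have tE : trivIset setT E.
  by move=> i j _ _ [x [/En -> /En ->]].
(* Dividing by [M n] makes the weighted excess of [U n] at most e/2^(n+1), and these sum to [e]. *)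
pose eps n := (e / (2 ^ n.+1)%:R / M n)%R.
have eps0 n : (0 < eps n)%R by apply: divr_gt0 => //; apply: divr_gt0 => //; rewrite ltr0n expn_gt0.
have muE n : mu (E n) < +oo.
  apply: (@le_lt_trans _ _ (mu D)); last by rewrite muD ltry.
  by apply: le_measure; rewrite ?inE// => x [].
have /choice[U UE] n := lebesgue_regularity_outer (mE n) (muE n) (eps0 n).
have muU n : (M n)%:E * mu (U n `&` `[a, b]) <=
    (M n)%:E * mu (E n) + (e / (2 ^ n.+1)%:R)%:E.
  have [oU EU muUE] := UE n.
  have mU : measurable (U n : set (measurableTypeR R)) by exact: open_measurable.
  have -> : (e / (2 ^ n.+1)%:R)%:E = (M n)%:E * (eps n)%:E.
    by rewrite -EFinM; congr EFin; rewrite [RHS]mulrC /eps divfK// gt_eqF.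
  rewrite -ge0_muleDr//; last by rewrite lee_fin ltW.
  apply: lee_wpmul2l; first by rewrite lee_fin ltW.
  apply: (@le_trans _ _ (mu (U n))).
    apply: le_measure; rewrite ?inE//; first exact: measurableI.
  rewrite -(setDUK EU) (le_trans (measureU2 _ _ _))//; first exact: measurableD.
  by apply: leeD2l; exact: ltW.
have := @increment_le_cover _ f a b U M e ab cf df.
move=> /(_ (fun n => let: And3 oU _ _ := UE n in oU) (fun n => ltW (M0 n)) _ e0).
have UM x : x \in `]a, b[%R -> exists2 n, U n x & (`|derive1 f x| < M n)%R.
  move=> xab; have : D x by [].
  rewrite DE => -[n _ Enx]; have [_ EU _] := UE n.
  by exists n; [exact: EU | have [_ /andP[]] := Enx].
move=> /(_ UM) /le_trans; apply.
apply: (@le_trans _ _ (e%:E + (\sum_(n <oo) (M n)%:E * mu (E n) + e%:E))).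
  apply: leeD2l; apply: le_trans (epsilon_trick _ _ (ltW e0)); last first.
    by move=> n; rewrite mule_ge0// lee_fin ltW.
  apply: lee_nneseries => // n _ _.
  by rewrite mule_ge0// lee_fin ltW.
have mg : measurable_fun D (fun x => (`|derive1 f x| + e)%:E).
  by apply/measurable_EFinP; exact: measurable_funD.
have g0 x : D x -> 0 <= (`|derive1 f x| + e)%:E.
  by rewrite lee_fin addr_ge0// ltW.
have int_g : \int[mu]_(x in D) (`|derive1 f x| + e)%:E =
    \int[mu]_(x in D) `|derive1 f x|%:E + (e * (b - a))%:E.
  under eq_integral do rewrite EFinD.
  rewrite ge0_integralD//; first by rewrite integral_cst// EFinM -muD.
  - exact/measurable_EFinP.
  - by move=> x _; rewrite lee_fin ltW.
(* On [E n] the constant [M n] equals n e + e, which is at most |f'| + [e]. *)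
have sumE : \sum_(n <oo) (M n)%:E * mu (E n) <=
    \int[mu]_(x in D) (`|derive1 f x| + e)%:E.
  rewrite [in leRHS]DE ge0_integral_bigcup -?DE//.
  apply: lee_nneseries => [n _ _|n _]; first by rewrite mule_ge0// lee_fin ltW.
  rewrite -integral_cst//; apply: ge0_le_integral => //.
  - by move=> x _; rewrite lee_fin ltW.
  - by apply: measurable_funS mg => // x [].
  - move=> x [_ /andP[nx _]]; rewrite lee_fin /M -natr1 mulrDl mul1r.
    by rewrite lerD2r.
apply: le_trans (leeD2l _ (leeD2r _ (le_trans sumE _))) _.
  by rewrite int_g.
rewrite rE !EFinD; have perm (I u w : \bar R) : u + (I + w + u) <= I + (u + u + w).
  by rewrite -!addeA [leLHS]addeCA [w + u]addeC.
exact: perm.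
Qed.

(** * The weighted inequality by exchange of integrals *)

(** Tonelli's theorem for g(t) h(y) on the triangle t < y: integrating in t first dominates u(y)
    h(y), and integrating in y first is dominated by C g(t) h(t). *)
Lemma weighted_integral_le (R : realType) (a b C : R) (u g h : R -> \bar R) :
  measurable_fun `]a, b[ u -> measurable_fun `]a, b[ g ->
  measurable_fun `]a, b[ h ->
  (forall x, x \in `]a, b[%R -> [/\ 0 <= u x, 0 <= g x & 0 <= h x]) ->
  (0 <= C)%R ->
  (forall y, y \in `]a, b[%R ->
    u y <= \int[@lebesgue_measure R]_(t in `]a, y[) g t) ->
  (forall t, t \in `]a, b[%R ->
    \int[@lebesgue_measure R]_(y in `]t, b[) h y <= C%:E * h t) ->
  \int[@lebesgue_measure R]_(x in `]a, b[) (u x * h x) <=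
  C%:E * \int[@lebesgue_measure R]_(x in `]a, b[) (g x * h x).
Proof.
move=> mu_ mg mh ugh0 C0 ug hC.
pose T := measurableTypeR R.
pose D : set T := `]a, b[%classic.
have mD : measurable D by exact: measurable_itv.
pose F (z : T * T) : \bar R :=
  if (z.1 < z.2)%R then (g \_ D) z.1 * (h \_ D) z.2 else 0.
have g0 x : D x -> 0 <= g x by move=> /ugh0[].
have h0 x : D x -> 0 <= h x by move=> /ugh0[].
have gD0 x : 0 <= (g \_ D) x by apply: erestrict_ge0 => y /g0.
have hD0 x : 0 <= (h \_ D) x by apply: erestrict_ge0 => y /h0.
have F0 z : 0 <= F z by rewrite /F; case: ifP => // _; rewrite mule_ge0.
have mgD : measurable_fun setT (g \_ D).
  by apply/(measurable_restrict _ mD measurableT); rewrite setTI.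
have mhD : measurable_fun setT (h \_ D).
  by apply/(measurable_restrict _ mD measurableT); rewrite setTI.
have mF : measurable_fun setT F.
  apply: measurable_fun_ifT.
  - exact: measurable_fun_ltr.
  - apply: emeasurable_funM.
      exact: (measurableT_comp mgD measurable_fst).
    exact: (measurableT_comp mhD measurable_snd).
  - exact: measurable_cst.
have FG y : D y ->
    \int[@lebesgue_measure R]_t F (t, y) =
    h y * \int[@lebesgue_measure R]_(t in `]a, y[) g t.
  move=> Dy; have yb : (y < b)%R by move: Dy; rewrite /D/= in_itv => /andP[].
  have ayD : `]a, y[ `<=` D by apply: subset_itvl; rewrite bnd_simp ltW.
  rewrite -ge0_integralZl//; last 3 first.
  - exact: measurable_funS mg.
  - by move=> t /ayD/g0.
  - exact: h0.
  rewrite [RHS]integral_mkcond; apply: eq_integral => t _.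
  rewrite /F/= !patchE (mem_set Dy) !mem_setE !in_itv/= muleC.
  have [ty|] := ltP t y; last by rewrite andbF.
  by rewrite (lt_trans ty yb); case: ifP => // _; rewrite mule0.
have FF t : D t ->
    \int[@lebesgue_measure R]_y F (t, y) =
    g t * \int[@lebesgue_measure R]_(y in `]t, b[) h y.
  move=> Dt; have at_ : (a < t)%R by move: Dt; rewrite /D/= in_itv => /andP[].
  have tbD : `]t, b[ `<=` D by apply: subset_itvr; rewrite bnd_simp ltW.
  rewrite -ge0_integralZl//; last 3 first.
  - exact: measurable_funS mh.
  - by move=> y /tbD/h0.
  - exact: g0.
  rewrite [RHS]integral_mkcond; apply: eq_integral => y _.
  rewrite /F/= !patchE (mem_set Dt) !mem_setE !in_itv/=.
  have [ty|] := ltP t y => //.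
  by rewrite (lt_trans at_ ty); case: ifP => // _; rewrite mule0.
have FF0 t : ~ D t -> \int[@lebesgue_measure R]_y F (t, y) = 0.
  move=> Dt; apply: integral0_eq => y _.
  by rewrite /F/= patchE memNset// mul0e if_same.
apply: (@le_trans _ _ (\int[@lebesgue_measure R]_(y in D) \int[@lebesgue_measure R]_t F (t, y))).
  apply: ge0_le_integral => //.
  - by move=> x Dx; rewrite mule_ge0//; case: (ugh0 x Dx).
  - exact: emeasurable_funM.
  - exact/measurable_funTS/measurable_fun_fubini_tonelli_G.
  - by move=> y Dy; rewrite FG// muleC lee_wpmul2l ?h0// ug.
(* The outer integral is extended to the whole line so that the Tonelli exchange applies. After the
   exchange it returns to [D], outside of which the inner integral vanishes by [FF0]. *)
apply: (@le_trans _ _ (\int[@lebesgue_measure R]_y \int[@lebesgue_measure R]_t F (t, y))).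
  apply: ge0_subset_integral => //; first exact: measurable_fun_fubini_tonelli_G.
  by move=> y _; exact: integral_ge0.
rewrite -fubini_tonelli//.
have -> : \int[@lebesgue_measure R]_t \int[@lebesgue_measure R]_y F (t, y) =
    \int[@lebesgue_measure R]_(t in D) \int[@lebesgue_measure R]_y F (t, y).
  rewrite [RHS]integral_mkcond; apply: eq_integral => t _.
  by rewrite patchE; case: ifPn => // /negP; rewrite inE => /FF0.
rewrite -ge0_integralZl//; last 2 first.
- exact: emeasurable_funM.
- by move=> x Dx; rewrite mule_ge0 ?g0 ?h0.
apply: ge0_le_integral => //.
- by move=> t _; exact: integral_ge0.
- exact/measurable_funTS/measurable_fun_fubini_tonelli_F.
- by apply: measurable_funeM; exact: emeasurable_funM.
- move=> t Dt; rewrite FF// muleCA lee_wpmul2l ?g0//; exact: hC.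
Qed.

(** Multiply the convergent quotient by h, which tends to 0. The general filter lets one statement
    serve the one-sided limits at both endpoints. *)
Lemma cvg_of_cvg_quotient (R : realType) (F : set_system R) (FF : Filter F)
    (f : R -> R) (c : R) :
  h @[h --> F] --> (0 : R)%R -> (\forall h \near F, h != 0)%R ->
  cvg ((h^-1 * (f h - c))%R @[h --> F]) -> f h @[h --> F] --> c.
Proof.
move=> F0 Fn0 /cvg_ex[/= l ql].
have : (h * (h^-1 * (f h - c)) + c)%R @[h --> F] --> (0 * l + c)%R.
  by apply: cvgD; [exact: cvgM | exact: cvg_cst].
rewrite mul0r add0r; apply: cvg_trans; apply: near_eq_cvg.
by apply: filterS Fn0 => h h0; rewrite mulVKf// subrK.
Qed.

Lemma differentiable01_continuous (R : realType) (f : R -> R) :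
  differentiable01 f -> {within `[0%R, 1%R], continuous f}.
Proof.
move=> [df df0 df1]; apply/continuous_within_itvP => //; split.
- by move=> x /df /derivable1_diffP; exact: differentiable_continuous.
- apply: cvg_of_cvg_quotient df0; first by apply: cvg_within_filter; exact: cvg_id.
  exact: nbhs_right_neq.
- have : f (1 + h)%R @[h --> 0^'-] --> f 1%R.
    apply: cvg_of_cvg_quotient df1; first by apply: cvg_within_filter; exact: cvg_id.
    exact: nbhs_left_neq.
  move=> /cvgrPdist_lt f1; apply/cvgrPdist_lt => e /f1[d /= d0 dP].
  exists d => // y /= yd y1; rewrite -(subrKC 1 y)%R; apply: dP.
    by rewrite /= sub0r opprB.
  by rewrite subr_lt0.
Qed.

(** Passes from the real-valued integral in [tail_ratio] to the extended-real one; the latter is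
    finite because [nu] is continuous on a compact interval. *)
Lemma tail_ratioE (R : realType) (nu : R -> R) (x : R) :
  {within `[0%R, 1%R], continuous nu} -> x \in `[0%R, 1%R] -> (0 < nu x)%R ->
  (nu x * tail_ratio nu x)%:E =
  \int[@lebesgue_measure R]_(z in `[x, 1%R]) (nu z)%:E.
Proof.
move=> cnu; rewrite in_itv/= => /andP[x0 x1] nux.
rewrite /tail_ratio mulVKf ?gt_eqF// fineK//.
have : (@lebesgue_measure R).-integrable `[x, 1%R] (EFin \o nu).
  apply: continuous_compact_integrable; first exact: segment_compact.
  by apply: continuous_subspaceW cnu; apply: subset_itvr; rewrite bnd_simp.
by move/integrable_fin_num; apply.
Qed.

(** The exchange lemma with u = |f|, g = |f'| and h = [nu]: the bound on u is the increment estimate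
    from 0, and the bound on the tails of h is [tail_ratio nu t <= C] multiplied by [nu t]. *)
Lemma weighted_hardy_upper (R : realType) (nu : R -> R) (C : R) (f : R -> R) :
  {within `[0%R, 1%R], continuous nu} ->
  (forall x, x \in `[0%R, 1%R] -> 0 < nu x)%R ->
  (forall x, x \in `[0%R, 1%R] -> tail_ratio nu x <= C)%R ->
  (0 <= C)%R ->
  differentiable01 f -> f 0%R = 0%R ->
  \int[@lebesgue_measure R]_(x in `[0%R, 1%R]) (`|f x| * nu x)%:E <=
  C%:E * \int[@lebesgue_measure R]_(x in `[0%R, 1%R]) (`|derive1 f x| * nu x)%:E.
Proof.
move=> cnu nu0 nuC C0 dif f0; have cf := differentiable01_continuous _ _ dif.
have [df _ _] := dif.
pose I : set (measurableTypeR R) := `]0%R, 1%R[%classic.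
have mI : measurable I by exact: measurable_itv.
have sub01 : I `<=` `[0%R, 1%R] by exact: subset_itv_oo_cc.
have mnu : measurable_fun I nu.
  apply: (measurable_funS (measurable_itv `[0%R, 1%R])) => //.
  exact: subspace_continuous_measurable_fun.
have mf : measurable_fun I (fun x => `|f x|%R).
  apply: measurableT_comp => //.
  apply: (measurable_funS (measurable_itv `[0%R, 1%R])) => //.
  exact: subspace_continuous_measurable_fun.
have mf' : measurable_fun I (fun x => `|derive1 f x|%R).
  apply: measurableT_comp => //; apply: measurable_derive1 => //.
  by move=> x; rewrite inE; exact: df.
(* Both integrals are moved to the open interval. At 0 and 1 [derive1 f] refers to a two-sided
   limit, which one-sided differentiability does not control, but the endpoints have measure
   zero. *)
rewrite [leLHS](@integral_itv_bndoo _ _ _ _ true false); last first.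
  by apply/measurable_EFinP; exact: measurable_funM.
rewrite [in leRHS](@integral_itv_bndoo _ _ _ _ true false); last first.
  by apply/measurable_EFinP; exact: measurable_funM.
under eq_integral do rewrite EFinM.
under [in leRHS]eq_integral do rewrite EFinM.
apply: weighted_integral_le => //.
- exact/measurable_EFinP.
- exact/measurable_EFinP.
- exact/measurable_EFinP.
- by move=> x /subset_itv_oo_cc/nu0 nux; split; rewrite lee_fin// ltW.
- move=> y; rewrite in_itv/= => /andP[y0 y1].
  have -> : (f y = f y - f 0)%R by rewrite f0 subr0.
  apply: increment_le_integral_derive1; first exact: ltW.
    by apply: continuous_subspaceW cf; apply: subset_itvl; rewrite bnd_simp ltW.
  by move=> x /subset_itvl xy; apply: df; apply: xy; rewrite bnd_simp ltW.
- move=> t t01; have t01' := subset_itv_oo_cc t01.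
  rewrite -(integral_itv_bndoo true false); last first.
    apply/measurable_EFinP; apply: measurable_funS mnu => //.
    by apply: subset_itvr; rewrite bnd_simp; move: t01; rewrite in_itv => /andP[/ltW].
  by rewrite -tail_ratioE ?nu0// -EFinM lee_fin mulrC ler_pM2r ?nuC ?nu0.
Qed.

(* A continuously differentiable step function *)
Local Close Scope ereal_scope.

(** The difference quotient differs from [l] by at most A |h|. This form allows derivatives of
    piecewise quadratic functions to be checked by arithmetic, even at the break points. *)
Lemma is_derive_quadratic_remainder (R : realType) (g : R -> R) (x l A : R) :
  (forall h, `|g (h + x) - g x - h * l| <= A * h ^+ 2) -> is_derive x 1 g l.
Proof.
move=> gA; have A0 : 0 <= A.
  by have := gA 1; rewrite expr1n mulr1; apply: le_trans.
have gl : (fun h => h^-1 *: ((g \o shift x) (h *: 1) - g x)) @ 0^' --> l.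
  apply/cvgrPdist_le => e e0; exists (e / (A + 1)) => /=.
    by rewrite divr_gt0// ltr_wpDl.
  move=> h /=; rewrite sub0r normrN => he h0; rewrite [h *: 1]mulr1 distrC.
  have -> : h^-1 *: (g (h + x) - g x) - l = h^-1 * (g (h + x) - g x - h * l).
    by rewrite mulrBr mulKf.
  rewrite normrM normfV mulrC ler_pdivrMr ?normr_gt0//.
  apply: le_trans (gA h) _.
  rewrite -(real_normK (num_real h)) expr2 mulrA ler_wpM2r//.
  move: he; rewrite ltr_pdivlMr; last by rewrite ltr_wpDl.
  have := normr_ge0 h; nra.
split; first by apply/cvg_ex; exists l.
exact/cvg_lim.
Qed.

(** The squared positive part is the building block of the step: its derivative is twice the
    positive part, with a quadratic remainder even across the kink at 0. *)
Lemma max0_sqr_remainder (R : realType) (x h : R) :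
  `|Num.max (h + x) 0 ^+ 2 - Num.max x 0 ^+ 2 - h * (2 * Num.max x 0)| <= h ^+ 2.
Proof.
rewrite ler_norml.
by case: (leP (h + x) 0) => hx; case: (leP x 0) => x0; apply/andP; split; nra.
Qed.

Lemma smooth_step (R : realType) (a d : R) : 0 < d ->
  exists f : R -> R, [/\ forall x, derivable f x 1,
    continuous (derive1 f),
    forall x, 0 <= derive1 f x,
    forall x, ~~ (a < x < a + d) -> derive1 f x = 0 &
    (forall x, x <= a -> f x = 0) /\ (forall x, a + d <= x -> f x = 1)].
Proof.
move=> d0; have [e e0 ->] : exists2 e : R, 0 < e & d = e + e.
  by exists (d / 2); rewrite ?divr_gt0// -splitr.
rewrite addrA.
(* The derivative of [k * q] is the hat function on [a, a + 2e] of area 1. *)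
pose m (u : R) := Num.max u 0.
pose q (x : R) : R := m (x - a) ^+ 2 - 2 * m (x - (a + e)) ^+ 2 + m (x - (a + e + e)) ^+ 2.
pose q' (x : R) : R := m (x - a) - 2 * m (x - (a + e)) + m (x - (a + e + e)).
pose k : R := (2 * e ^+ 2)^-1.
have k0 : 0 < k by rewrite invr_gt0 mulr_gt0 ?exprn_gt0.
have df (x : R) : is_derive x 1 (fun x : R => k * q x) (k * (2 * q' x)).
  (* The factor 4 is 1 + 2 + 1, the sum of the absolute coefficients of the three squares in [q]. *)
  apply: (@is_derive_quadratic_remainder _ _ _ _ (k * 4)) => h.
  have -> : k * q (h + x) - k * q x - h * (k * (2 * q' x)) =
     k * (q (h + x) - q x - h * (2 * q' x)) by ring.
  rewrite normrM gtr0_norm// -mulrA ler_pM2l// /q /q' -!addrA !(addrA h).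
  have := max0_sqr_remainder _ (x - a) h.
  have := max0_sqr_remainder _ (x - (a + e)) h.
  have := max0_sqr_remainder _ (x - (a + e + e)) h.
  rewrite /m !addrA !ler_norml => /andP[? ?] /andP[? ?] /andP[? ?].
  apply/andP; split; lra.
have dfE : derive1 (fun x : R => k * q x) = (fun x => k * (2 * q' x)).
  by apply/funext => x; rewrite derive1E; exact: derive_val.
(* Splitting each positive part this way reduces the claims on [q'] to linear arithmetic. *)
have mE (u : R) : (m u = u /\ 0 <= u) \/ (m u = 0 /\ u <= 0).
  by rewrite /m; case: leP => u0; [left|right]; split => //; exact: ltW.
exists (fun x : R => k * q x); rewrite dfE; split.
- by move=> x; exact: ex_derive.
- have cm c : continuous (fun x : R => m (x - c)).
    move=> x; apply: (@continuous_max _ _ (fun x => x - c) (cst 0)); last exact: cvg_cst.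
    by apply: cvgB; [exact: cvg_id|exact: cvg_cst].
  move=> x; apply: cvgM; first exact: cvg_cst.
  apply: cvgM; first exact: cvg_cst.
  apply: cvgD; last exact: cm.
  apply: cvgB; first exact: cm.
  by apply: cvgM; [exact: cvg_cst | exact: cm].
- move=> x; apply: mulr_ge0; first exact: ltW.
  apply: mulr_ge0 => //; rewrite /q'.
  by case: (mE (x - a)) => -[-> ?]; case: (mE (x - (a + e))) => -[-> ?];
    case: (mE (x - (a + e + e))) => -[-> ?]; lra.
- move=> x; rewrite negb_and -!leNgt => xad.
  suff -> : q' x = 0 by rewrite !mulr0.
  move: xad; rewrite /q' => /orP[] ?;
  case: (mE (x - a)) => -[-> ?]; case: (mE (x - (a + e))) => -[-> ?];
    case: (mE (x - (a + e + e))) => -[-> ?]; lra.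
- split=> x xa.
    suff -> : q x = 0 by rewrite mulr0.
    rewrite /q /m !max_r ?expr0n/= ?mulr0 ?subrr ?addr0//; lra.
  suff -> : q x = 2 * e ^+ 2 by rewrite mulVf// gt_eqF// -invr_gt0.
  by rewrite /q /m !max_l; [ring|lra..].
Qed.

(** * Sharpness of the constant *)

Local Open Scope ereal_scope.

(** The integral of [nu] is at least its minimum over [0, 1], which is positive. This makes the
    maximum [C] positive and so keeps a maximiser away from 1. *)
Lemma tail_ratio0_gt0 (R : realType) (nu : R -> R) :
  {within `[0%R, 1%R], continuous nu} ->
  (forall x, x \in `[0%R, 1%R] -> 0 < nu x)%R -> (0 < tail_ratio nu 0)%R.
Proof.
move=> cnu nu0; have in0 : (0 : R)%R \in `[0%R, 1%R] by rewrite in_itv/= lexx ler01.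
have [c c01 cmin] := EVT_min (@ler01 R) cnu.
have mnu : measurable_fun (`[0%R, 1%R] : set (measurableTypeR R)) nu.
  exact: subspace_continuous_measurable_fun.
rewrite -(pmulr_rgt0 _ (nu0 _ in0)) -lte_fin tail_ratioE// ?nu0//.
apply: (@lt_le_trans _ _ (nu c)%:E); first by rewrite lte_fin nu0.
have -> : (nu c)%:E = \int[@lebesgue_measure R]_(x in `[0%R, 1%R]) (nu c)%:E.
  by rewrite integral_cst//= lebesgue_measure_itv/= lte01 oppr0 adde0 mule1.
apply: ge0_le_integral => //.
- by move=> x _; rewrite lee_fin ltW ?nu0.
- exact/measurable_EFinP.
Qed.

(** Replace [nu] by [M] wherever f' is nonzero; as f' is continuous and nonnegative, the fundamental
    theorem of calculus evaluates what remains. *)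
Lemma weighted_integral_derive1_le (R : realType) (nu f : R -> R) (M : R) :
  {within `[0%R, 1%R], continuous nu} ->
  (forall x, x \in `[0%R, 1%R] -> 0 < nu x)%R ->
  (forall x, derivable f x 1) -> continuous (derive1 f) ->
  (forall x, 0 <= derive1 f x)%R ->
  (forall x, x \in `[0%R, 1%R] -> derive1 f x != 0%R -> nu x <= M)%R ->
  \int[@lebesgue_measure R]_(x in `[0%R, 1%R]) (`|derive1 f x| * nu x)%:E <=
  (M * (f 1 - f 0))%:E.
Proof.
move=> cnu nu0 df cf' f'0 nuM.
have cf : continuous f.
  by move=> x; exact/differentiable_continuous/derivable1_diffP.
have mnu : measurable_fun (`[0%R, 1%R] : set (measurableTypeR R)) nu.
  exact: subspace_continuous_measurable_fun.
have cwf' : {within `[0%R, 1%R], continuous (derive1 f)}.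
  exact: (continuous_subspaceT cf').
have mf' : measurable_fun (`[0%R, 1%R] : set (measurableTypeR R)) (derive1 f).
  exact: (subspace_continuous_measurable_fun (measurable_itv _) cwf').
have LR : derivable_oo_LRcontinuous f 0 1.
  split=> [x _||]; [exact: df|apply: cvg_at_right_filter|apply: cvg_at_left_filter];
  exact: cf.
have FTC := continuous_FTC2 ltr01 cwf' LR (fun x _ => erefl).
rewrite EFinM EFinB -FTC.
rewrite -integralZl//; last first.
  by apply: continuous_compact_integrable; first exact: segment_compact.
apply: ge0_le_integral => //.
- by move=> x x01; rewrite lee_fin mulr_ge0 // ltW ?nu0.
- by apply/measurable_EFinP/measurable_funM => //; exact: measurableT_comp.
- by apply: measurable_funeM; exact/measurable_EFinP.
- move=> x x01; rewrite -EFinM lee_fin ger0_norm// mulrC.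
  have [->|f'x] := eqVneq (derive1 f x) 0%R; first by rewrite !mulr0.
  by rewrite ler_wpM2r// nuM.
Qed.

Lemma weighted_hardy_sharp (R : realType) (nu : R -> R) (x0 c : R) :
  {within `[0%R, 1%R], continuous nu} ->
  (forall x, x \in `[0%R, 1%R] -> 0 < nu x)%R ->
  (0 <= x0 < 1)%R -> (0 <= c < tail_ratio nu x0)%R ->
  exists f : R -> R, [/\ (forall x, derivable f x 1), f 0%R = 0%R &
    c%:E * \int[@lebesgue_measure R]_(x in `[0%R, 1%R]) (`|derive1 f x| * nu x)%:E <
    \int[@lebesgue_measure R]_(x in `[0%R, 1%R]) (`|f x| * nu x)%:E].
Proof.
move=> cnu nu0 /andP[x00 x01] /andP[c0 cC].
have x0in : x0 \in `[0%R, 1%R] by rewrite in_itv/= x00 ltW.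
have nux0 := nu0 _ x0in.
have := tail_ratioE _ _ _ cnu x0in nux0.
move: (tail_ratio nu x0) cC => C cC CE.
(* [M] bounds [nu] just to the right of [x0], so that [int |f'| nu <= M]. *)
have [M nux0M cM] : exists2 M : R, (nu x0 < M)%R & (c * M < C * nu x0)%R.
  exists (nu x0 + (C - c) * nu x0 / (c + 1))%R.
    by rewrite ltrDl divr_gt0 ?mulr_gt0 ?subr_gt0 ?ltr_wpDl.
  (* The divisor c + 1 is positive even for c = 0, and leaves a gap of exactly (C - c) nu(x0) / (c +
     1). *)
  have -> : (c * (nu x0 + (C - c) * nu x0 / (c + 1)) =
      C * nu x0 - (C - c) * nu x0 / (c + 1))%R.
    by field; rewrite gt_eqF// ltr_wpDl.
  by rewrite ltrBlDr ltrDl divr_gt0 ?mulr_gt0 ?subr_gt0 ?ltr_wpDl.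
have M0 : (0 < M)%R by exact: lt_trans nux0M.
have [r r0 nuM] : exists2 r : R, (0 < r)%R &
    forall x, (x0 < x < x0 + r)%R -> (nu x < M)%R.
  have : {within `[x0, 1%R], continuous nu}.
    by apply: continuous_subspaceW cnu; apply: subset_itvr; rewrite bnd_simp.
  move=> /(continuous_within_itvP _ x01)[_ cx0 _].
  have [r /= r0 rP] : \forall x \near x0^'+, (nu x < M)%R.
    by apply: (cvgr_lt _ cx0).
  exists r => // x /andP[x0x xr]; apply: rP => //=.
  by rewrite distrC ger0_norm ?subr_ge0 ?ltW// ltrBlDl.
(* The width [d] of the step: [d <= r] keeps [nu] below [M] on the support of f', [x0 + d <= 1]
   gives f(1) = 1, and the last condition absorbs the mass of [nu] lost under the rise, at most
   [d * M]. *)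
have [d [d0 dr d1 dM]] : exists d : R, [/\ 0 < d, d <= r, x0 + d <= 1 &
    c * M + d * M < C * nu x0]%R.
  have [s s0 sM] : exists2 s : R, (0 < s)%R & (c * M + s * M < C * nu x0)%R.
    exists ((C * nu x0 - c * M) / M / 2)%R; first by rewrite !divr_gt0 ?subr_gt0.
    by rewrite mulrAC divfK ?gt_eqF//; move: cM; lra.
  exists (Num.min s (Num.min r (1 - x0)%R)); split.
  - by rewrite !lt_min s0 r0 subr_gt0.
  - by rewrite !ge_min lexx orbT.
  - by rewrite -lerBrDl !ge_min lexx !orbT.
  - by apply: le_lt_trans sM; rewrite lerD2l ler_pM2r// ge_min lexx.
have [f [df cf' f'0 f'out [fl fr]]] := smooth_step _ x0 d d0.
have f00 : f 0%R = 0%R by exact: fl.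
exists f; split=> //.
have upper := @weighted_integral_derive1_le R nu f M cnu nu0 df cf' f'0.
apply: (@le_lt_trans _ _ (c * M)%:E).
  rewrite EFinM lee_wpmul2l ?lee_fin//.
  apply: le_trans (upper _) _; last by rewrite f00 (fr 1%R)// subr0 mulr1.
  move=> x _ f'x; have : (x0 < x < x0 + d)%R.
    by apply: contraNT f'x => /f'out ->.
  move=> /andP[x0x xd]; apply/ltW/nuM; rewrite x0x/=.
  by apply: lt_le_trans xd _; rewrite lerD2l.
have mnu : measurable_fun (`[0%R, 1%R] : set (measurableTypeR R)) nu.
  exact: subspace_continuous_measurable_fun.
have cf : continuous f.
  by move=> x; exact/differentiable_continuous/derivable1_diffP.
have mf : measurable_fun (`[0%R, 1%R] : set (measurableTypeR R)) (fun x => `|f x|%R).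
  apply: measurableT_comp => //.
  by apply: subspace_continuous_measurable_fun => //; exact: continuous_subspaceT.
have sub : `[x0, 1%R]%classic `<=` `[0%R, 1%R]%classic.
  by apply: subset_itvr; rewrite bnd_simp.
have subd : `[(x0 + d)%R, 1%R]%classic `<=` `[x0, 1%R]%classic.
  by apply: subset_itvr; rewrite bnd_simp lerDl ltW.
(* Only the plateau to the right of [x0 + d], where f = 1, is retained from the integral of |f|
   [nu]. *)
apply: (@lt_le_trans _ _ (\int[@lebesgue_measure R]_(x in `[(x0 + d)%R, 1%R]) (nu x)%:E)); last first.
  have -> : \int[@lebesgue_measure R]_(x in `[(x0 + d)%R, 1%R]) (nu x)%:E =
      \int[@lebesgue_measure R]_(x in `[(x0 + d)%R, 1%R]) (`|f x| * nu x)%:E.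
    apply: eq_integral => x; rewrite inE/= in_itv/= => /andP[/fr -> _].
    by rewrite normr1 mul1r.
  apply: ge0_subset_integral => //.
  - by apply/measurable_EFinP; exact: measurable_funM.
  - by move=> x x01'; rewrite lee_fin mulr_ge0// ltW ?nu0.
  - exact: subset_trans sub.
have J0 : 0 <= \int[@lebesgue_measure R]_(x in `[(x0 + d)%R, 1%R]) (nu x)%:E.
  by apply: integral_ge0 => x /subd/sub/nu0 nux; rewrite lee_fin ltW.
have mnux0 : measurable_fun (`[x0, 1%R] : set (measurableTypeR R)) (EFin \o nu).
  by apply/measurable_EFinP; exact: measurable_funS mnu.
have near_x0 : \int[@lebesgue_measure R]_(x in `[x0, (x0 + d)%R[) (nu x)%:E <= (d * M)%:E.
  have -> : (d * M)%:E = \int[@lebesgue_measure R]_(x in `[x0, (x0 + d)%R[) M%:E.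
    rewrite integral_cst//= lebesgue_measure_itv/= lte_fin ltrDl d0 -EFinD.
    by rewrite -EFinM addrAC subrr add0r mulrC.
  have subl : `[x0, (x0 + d)%R[%classic `<=` `[x0, 1%R]%classic.
    by apply: subset_itvl; rewrite bnd_simp.
  apply: ge0_le_integral => //.
  - by move=> x /subl/sub/nu0 nux; rewrite lee_fin ltW.
  - exact: measurable_funS mnux0.
  - move=> x; rewrite /= in_itv/= => /andP[]; rewrite le_eqVlt => /predU1P[<- _|x0x xd].
      by rewrite lee_fin ltW.
    rewrite lee_fin ltW// nuM// x0x/=.
    by apply: lt_le_trans xd _; rewrite lerD2l.
(* The full tail from [x0] has mass C nu(x0), so the plateau carries at least C nu(x0) - d M, which
   exceeds c M by the choice of [d]. *)
have : (nu x0 * C)%:E <= (d * M)%:E +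
    \int[@lebesgue_measure R]_(x in `[(x0 + d)%R, 1%R]) (nu x)%:E.
  rewrite CE.
  rewrite (@itv_bndbnd_setU _ _ (BLeft x0) (BLeft (x0 + d)%R)); last 2 first.
  - by rewrite bnd_simp lerDl ltW.
  - by rewrite bnd_simp.
  rewrite ge0_integral_setU//.
  - exact: leeD2r.
  - by rewrite -itv_bndbnd_setU// bnd_simp// lerDl ltW.
  - move=> x; rewrite -itv_bndbnd_setU; last 2 first.
    + by rewrite bnd_simp lerDl ltW.
    + by rewrite bnd_simp.
    by move=> /sub/nu0 nux; rewrite lee_fin ltW.
  - apply/disj_setPS => x /= []; rewrite !in_itv/= => /andP[_ xd] /andP[dx _].
    by rewrite ltNge dx in xd.
case: (\int[_]_(x in _) _) J0 => [j| |] //= _.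
  by rewrite -EFinD lee_fin lte_fin; move: dM; lra.
by rewrite ltry.
Qed.

(* Assembling the two halves *)
Local Close Scope ereal_scope.

Lemma derivable_differentiable01 (R : realType) (f : R -> R) :
  (forall x, derivable f x 1) -> differentiable01 f.
Proof.
move=> df; split; first by move=> x _; exact: df.
  have /derivable1_cvg/cvg_dnbhs_at_right f0 := df 0.
  apply/cvg_ex; exists (derive1 f 0); apply: cvg_trans f0.
  by apply: near_eq_cvg; apply: nearW => h; rewrite addr0.
have /derivable1_cvg/cvg_dnbhs_at_left f1 := df 1.
apply/cvg_ex; exists (derive1 f 1); apply: cvg_trans f1.
by apply: near_eq_cvg; apply: nearW => h; rewrite [1 + h]addrC.
Qed.

Theorem theorem5 (R : realType) (nu : R -> R)
  (nu_cont : {within `[0, 1], continuous nu})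
  (nu_pos : forall x : R, x \in `[0, 1] -> 0 < nu x)
  (C : R)
  (C_max : (exists2 x0 : R, x0 \in `[0, 1] & C = tail_ratio nu x0) /\
           (forall x : R, x \in `[0, 1] -> tail_ratio nu x <= C)) :
  (forall f : R -> R, differentiable01 f -> f 0 = 0 ->
     (\int[@lebesgue_measure R]_(x in `[0%R, 1%R]) (`|f x| * nu x)%:E <=
      C%:E * \int[@lebesgue_measure R]_(x in `[0%R, 1%R]) (`|derive1 f x| * nu x)%:E)%E)
  /\
  (forall c : R, c < C ->
     exists f : R -> R, [/\ differentiable01 f, f 0 = 0 &
     (c%:E * \int[@lebesgue_measure R]_(x in `[0%R, 1%R]) (`|derive1 f x| * nu x)%:E <
      \int[@lebesgue_measure R]_(x in `[0%R, 1%R]) (`|f x| * nu x)%:E)%E]).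
Proof.
have [[x0 x0in CE] Cmax] := C_max.
have C_gt0 : 0 < C.
  apply: lt_le_trans (tail_ratio0_gt0 _ _ nu_cont nu_pos) (Cmax 0 _).
  by rewrite in_itv/= lexx ler01.
split=> [f dif f0|c cC]; first by apply: weighted_hardy_upper => //; exact: ltW.
(* At 1 the tail is an integral over a single point, hence zero, whereas C > 0. *)
have x01 : 0 <= x0 < 1.
  have := x0in; rewrite in_itv/= lt_neqAle => /andP[-> ->]; rewrite andbT.
  apply/eqP => x0E; move: C_gt0.
  by rewrite CE x0E /tail_ratio set_itv1 Rintegral_set1 mulr0 ltxx.
(* A negative [c] is raised to 0, still below [C]; the strict inequality for the larger constant
   gives that for [c], since the integral it multiplies is nonnegative. *)
have cC' : 0 <= Num.max c 0 < tail_ratio nu x0.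
  by rewrite le_max lexx orbT gt_max -CE cC.
have [f [df f0 cf]] := weighted_hardy_sharp _ _ _ _ nu_cont nu_pos x01 cC'.
exists f; split => //; first exact: derivable_differentiable01.
apply: le_lt_trans cf; apply: lee_wpmul2r.
  by apply: integral_ge0 => x /nu_pos nux; rewrite lee_fin mulr_ge0// ltW.
by rewrite lee_fin le_max lexx.
Qed.
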